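(* Let $\mathcal{F}^*$ be a nonprincipal ultrafilter on $\mathbb{N}$ containing the Müntz-Szász filter $\mathcal{F}^{MSz}$. Then the map $\Phi_{\mathcal{F}^*}:\mathcal{D}_{\mathrm{co}}\to{}^*\mathbb{R}=\mathbb{R}^{\mathbb{N}}/\mathcal{F}^*$, $\mu\mapsto[s(\mu)]$, is injective.
   Context: $\mathbb{N}$ is the set of natural numbers including $0$. $\mathcal{D}_{\mathrm{co}}$ is the set of finite positive Borel measures $\mu$ on $[0,\infty)$ for which there exist $0<a<b<\infty$ with $\operatorname{supp}\mu\subset[a,b]$. For $\mu\in\mathcal{D}_{\mathrm{co}}$ the moments are $s_k(\mu)=\int_0^\infty t^k\,d\mu(t)$, $k\in\mathbb{N}$, and $s(\mu)=(s_k(\mu))_{k\in\mathbb{N}}$ is the moment sequence. Given a nonprincipal ultrafilter $\mathcal{F}^*$ on $\mathbb{N}$, the hyperreal numbers are ${}^*\mathbb{R}=\mathbb{R}^{\mathbb{N}}/\mathcal{F}^*$, where two sequences $r,t\in\mathbb{R}^{\mathbb{N}}$ define the same class, $[r]=[t]$, if and only if $\{n\in\mathbb{N}\mid t_n=r_n\}\in\mathcal{F}^*$. Let $\vartheta$ be the $\sigma$-additive measure on (all subsets of) $\mathbb{N}$ with $\vartheta(\{0\})=0$ and $\vartheta(\{n\})=\frac1n$ for $n\ge1$. The Müntz-Szász filter $\mathcal{F}^{MSz}$ on $\mathbb{N}$ is defined by: $L\in\mathcal{F}^{MSz}$ if and only if $\vartheta(\mathbb{N}\setminus L)<\infty$.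 *)

(* Defs.v *)
From HB Require Import structures.
From mathcomp Require Import all_boot all_order all_algebra.
From mathcomp Require Import generic_quotient.
From mathcomp Require Import all_classical all_reals all_analysis.

Set Implicit Arguments.
Unset Strict Implicit.
Unset Printing Implicit Defensive.

Import Order.TTheory GRing.Theory Num.Theory.
Import numFieldNormedType.Exports.

Local Open Scope classical_set_scope.
Local Open Scope quotient_scope.
Local Open Scope ring_scope.

Section CompactlySupportedMeasures.
Context {R : realType}.

(* A Borel measure on [0, +oo[ is represented by a Borel measure on the whole
   line that gives mass 0 to ]-oo, 0[ (see [Dco]). Since the values of a
   MathComp-Analysis measure on non-measurable sets are irrelevant, two such
   measures are to be compared on Borel sets only. *)
Definition borel_finite_measure :=
  {finite_measure set (measurableTypeR R) -> \bar R}.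

(* The points all of whose open neighbourhoods have positive mass, i.e. the
   complement of the largest open null set. *)
Definition msupport (mu : borel_finite_measure) : set R :=
  [set x | forall U : set R, open U -> U x -> (0 < mu U)%E].

Definition Dco : set borel_finite_measure :=
  [set mu : borel_finite_measure | mu `]-oo, 0[%classic = 0%E /\
     exists a b : R, [/\ 0 < a, a < b & msupport mu `<=` `[a, b]%classic]].

(* For [mu] in [Dco] the integrand is bounded mu-almost everywhere, so the
   real-valued integral is the genuine (finite) one. *)
Definition moment (mu : borel_finite_measure) (k : nat) : R :=
  \int[mu]_(t in `[0, +oo[%classic) (t ^+ k).

End CompactlySupportedMeasures.

Section Hyperreals.
Variables (R : realType) (F : set_system nat).
Context {FU : UltraFilter F}.

Definition hyper_rel (r t : nat -> R) : bool := `[< F [set n | t n = r n] >].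

Lemma hyper_rel_refl : reflexive hyper_rel.
Proof.
by move=> r; apply/asboolP; apply: filterS filterT => n _.
Qed.

Lemma hyper_rel_sym : symmetric hyper_rel.
Proof.
move=> r t; apply/asboolP/asboolP; apply: filterS => n /= e; exact/esym/e.
Qed.

Lemma hyper_rel_trans : transitive hyper_rel.
Proof.
move=> t r u /asboolP rt /asboolP tu; apply/asboolP.
by apply: filterS2 rt tu => n /= <- ->.
Qed.

Canonical hyper_equiv : equiv_rel (nat -> R) :=
  EquivRel hyper_rel hyper_rel_refl hyper_rel_sym hyper_rel_trans.

Definition hyperreal : Type := {eq_quot hyper_equiv}.

Definition hyper_class (r : nat -> R) : hyperreal := \pi_{eq_quot hyper_equiv} r.

Lemma hyper_classP (r t : nat -> R) :
  hyper_class r = hyper_class t <-> F [set n | t n = r n].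
Proof. by split=> [/eqmodP/asboolP|h]//; apply/eqmodP/asboolP. Qed.

(* The map Phi; it is considered on [Dco] only. *)
Definition Phi (mu : @borel_finite_measure R) : hyperreal :=
  hyper_class (moment mu).

End Hyperreals.

Arguments hyperreal R F {FU}.
Arguments hyper_class {R} F {FU} r.
Arguments Phi {R} F {FU} mu.

Section MuntzSzaszFilter.
Variable R : realType.

Definition recip_nng (n : nat) : {nonneg R} := (n%:R^-1)%:nng.

(* \sum_n n^-1 \d_n; the term n = 0 vanishes because 0^-1 = 0 in MathComp. *)
Definition vartheta : {measure set nat -> \bar R} :=
  mseries (fun n : nat => mscale (recip_nng n) (dirac n)) 0.

Lemma vartheta_set1 (n : nat) : vartheta [set n] = (n%:R^-1)%:E.
Proof.
rewrite /vartheta /= /mseries (@nneseriesD1 _ _ n)//.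
rewrite eseries0 ?adde0 => [|k _ /= kn]; rewrite /= /mscale /= diracE.
  by rewrite mem_set// mule1.
by rewrite memNset ?mule0//=; exact/eqP.
Qed.

Definition MSz_filter : set_system nat :=
  [set L | (vartheta (~` L) < +oo)%E].

End MuntzSzaszFilter.

(* Main.v *)
Require Import Defs.
From mathcomp Require Import all_boot all_order all_algebra.
From mathcomp Require Import all_classical all_reals all_analysis.
From mathcomp Require Import measurable_realfun ring lra.

(** Equality of the two hyperreals says that the set [L] of exponents at which
    the moments of [mu] and [nu] agree belongs to the ultrafilter [F]. If the
    reciprocals of [L] had a finite sum, the complement of [L] would belong to
    the Müntz-Szász filter, hence to [F], and [F] would contain the empty set.
    So the reciprocals of [L] have an infinite sum. It remains to see that a
    measure carried by an interval [[a, b]] with [0 < a] is determined by its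
    moments of exponents in such an [L].

    First, all moments of positive exponent agree ([eq_moments]). This is the
    Müntz theorem, by von Golitschek's argument: [x ^ q] plus a suitable
    combination of the [x ^ l], [l] in a finite subset [s] of [L], is bounded
    on [[0, b]] by [b ^ q] times the product of the [|1 - q / l|]
    ([muntz_approx]), and divergence makes this product arbitrarily small
    ([muntz_prod_small]). Exponents are added one at a time. The usual proof of
    the bound estimates an integral; here it is read off a first order
    differential equation at a point where the modulus is maximal
    ([first_order_max_principle]), so that everything stays within polynomials.

    Secondly, moments of positive exponent determine the mass of each ray
    [[c, +oo[] with [0 < c] ([eq_measure_rays]): the indicator of the ray is on
    [[0, b]] the bounded pointwise limit of explicit polynomials without
    constant term ([cvg_step_poly]), and dominated convergence applies. As the
    complement of [[a, b]] is null ([measure_setC_support]), rays with [c <= a]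
    and the whole line have the mass of [[a, +oo[], and rays form a
    pi-system generating the Borel sets. *)

Local Open Scope classical_set_scope.

Import Order.TTheory GRing.Theory Num.Theory.
Import numFieldNormedType.Exports.

(** * Müntz approximation by polynomials *)

Section Muntz.
Local Open Scope ring_scope.
Variable R : realType.
Implicit Types (Q : {poly R}) (b M : R) (q l : nat).

Lemma horner_max_norm b Q : 0 <= b ->
  exists2 c, 0 <= c <= b & forall x, 0 <= x <= b -> `|Q.[x]| <= `|Q.[c]|.
Proof.
move=> b0.
have cQ : {within `[0, b], continuous (fun x => `|Q.[x]|)}.
  apply: continuous_subspaceT => x.
  by apply: continuous_comp; [exact: continuous_horner|exact: norm_continuous].
have [c] := EVT_max b0 cQ.
rewrite in_itv/= => cb cmax; by exists c.
Qed.

Lemma deriv_at_max_norm b Q c : 0 < c < b ->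
  (forall x, 0 <= x <= b -> `|Q.[x]| <= `|Q.[c]|) -> Q^`().[c] = 0.
Proof.
move=> /andP[c0 cb] cmax.
have cin : c \in `]0, b[%R by rewrite in_itv/= c0.
have b0 : 0 <= b by rewrite ltW// (lt_trans c0).
wlog Qc : Q cmax / 0 <= Q.[c].
  move=> H; have [|Qc] := leP 0 Q.[c]; first exact: H.
  apply/eqP; rewrite -oppr_eq0 -hornerN -derivN; apply/eqP; apply: H.
    by move=> x /cmax; rewrite !hornerN !normrN.
  by rewrite hornerN oppr_ge0 ltW.
rewrite derivE derive1E.
apply: derive_val; apply: (derive1_at_max b0) cin _ => [t _|t].
  exact: derivable_horner.
rewrite in_itv/= => /andP[t0 tb]; rewrite -(ger0_norm Qc).
by rewrite (le_trans (ler_norm _))// cmax// !ltW.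
Qed.

(** Where [|P|] is maximal on [[0, b]], either [P] vanishes (at an endpoint) or
    [P^`()] does; in the second case the differential equation reduces to
    [P = (1 - q / l) Q] at that point. *)
Lemma first_order_max_principle b l q M (P Q : {poly R}) :
  0 < b -> (0 < l)%N -> P.[0] = 0 -> P.[b] = 0 ->
  'X * P^`() - l%:R *: P = (q%:R - l%:R) *: Q ->
  (forall x, 0 <= x <= b -> `|Q.[x]| <= M) ->
  forall x, 0 <= x <= b -> `|P.[x]| <= `|1 - q%:R / l%:R| * M.
Proof.
move=> b0 l0 P0 Pb PQ QM.
have M0 : 0 <= M by rewrite (le_trans (normr_ge0 _) (QM 0 _))// lexx ltW.
have [c cb cmax] := horner_max_norm _ P (ltW b0).
move=> x xb; apply: (le_trans (cmax _ xb)).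
have [->|cN0] := eqVneq c 0; first by rewrite P0 normr0 mulr_ge0.
have [->|cNb] := eqVneq c b; first by rewrite Pb normr0 mulr_ge0.
have c0b : 0 < c < b.
  by case/andP: cb => c0 cb; rewrite !lt_neqAle c0 cb cNb eq_sym cN0.
have := congr1 (horner^~ c) PQ.
rewrite !hornerE (deriv_at_max_norm _ _ _ c0b cmax) mulr0 add0r => PQc.
have lN0 : l%:R != 0 :> R by rewrite pnatr_eq0 -lt0n.
have -> : P.[c] = (1 - q%:R / l%:R) * Q.[c].
  apply: (mulfI lN0); apply: oppr_inj; rewrite PQc; by field.
by rewrite normrM ler_wpM2l// QM.
Qed.

(** For [Q] without term in ['X^l], the solution [S] of
    [X S' - l S = (q - l) Q] that vanishes at [b]: the equation fixes every
    coefficient but the one of ['X^l], which is free and serves to impose the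
    boundary value. In integral form, [S x] is [(l - q) x ^ l] times the
    integral of [Q t / t ^ (l + 1)] for [t] from [x] to [b]. At [k = l] the division by zero gives a zero coefficient. *)
Definition muntz_step b l q Q : {poly R} :=
  let P := \poly_(k < size Q) ((q%:R - l%:R) / (k%:R - l%:R) * Q`_k) in
  P - (P.[b] / b ^+ l) *: 'X^l.

Lemma coef_muntz_step b l q Q k : k != l ->
  (muntz_step b l q Q)`_k = (q%:R - l%:R) / (k%:R - l%:R) * Q`_k.
Proof.
move=> kl; rewrite /muntz_step coefB coefZ coefXn (negbTE kl) mulr0 subr0.
by rewrite coef_poly; case: ltnP => // /(nth_default 0) ->; rewrite mulr0.
Qed.

(** In degree [l] the equation reads [0 = (q - l) Q`_l], whence the hypothesis
    that [Q] does not already involve the exponent [l]. *)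
Lemma muntz_step_ode b l q Q : Q`_l = 0 ->
  'X * (muntz_step b l q Q)^`() - l%:R *: muntz_step b l q Q
  = (q%:R - l%:R) *: Q.
Proof.
move=> Ql; apply/polyP => k; rewrite coefB coefXM coefZ coefZ.
have -> : (if k == 0%N then 0 else (muntz_step b l q Q)^`()`_k.-1) =
    k%:R * (muntz_step b l q Q)`_k.
  by case: k => [|k]/=; rewrite ?mul0r// coef_deriv mulr_natl.
rewrite -mulrBl; have [->|kl] := eqVneq k l; first by rewrite subrr Ql mulr0 mul0r.
rewrite coef_muntz_step//; field.
by rewrite subr_eq0 eqr_nat.
Qed.

Lemma muntz_step_end b l q Q : 0 < b -> (muntz_step b l q Q).[b] = 0.
Proof. by move=> b0; rewrite !hornerE divfK ?subrr// expf_neq0// gt_eqF. Qed.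

(** Induction on the list of exponents: one step adds the exponent [l],
    preserves the support and the coefficient 1 of ['X^q], and by the maximum
    principle costs a factor [|1 - q / l|]. Positivity of the exponents makes
    the polynomials vanish at 0, as that principle requires. *)
Lemma muntz_approx b q (s : seq nat) : 0 < b -> (0 < q)%N ->
  uniq s -> {in s, forall l, (0 < l)%N && (l != q)} ->
  exists Q, [/\ Q`_q = 1, forall k, Q`_k != 0 -> k = q \/ k \in s &
    forall x, 0 <= x <= b ->
      `|Q.[x]| <= (\prod_(l <- s) `|1 - q%:R / l%:R|) * b ^+ q].
Proof.
move=> b0 q0; elim: s => [_ _|l s IH /=/andP[ls us] sq].
  exists 'X^q; split => [|k|x /andP[x0 xb]]; first by rewrite coefXn eqxx.
    by rewrite coefXn; have [->|_] := eqVneq k q; [left|rewrite eqxx].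
  by rewrite big_nil mul1r !hornerE ger0_norm ?exprn_ge0// lerXn2r// nnegrE// ltW.
have /IH : {in s, forall l, (0 < l)%N && (l != q)}.
  by move=> k ks; apply: sq; rewrite inE ks orbT.
case/(_ us) => Q [Qq Qs Qle].
have /andP[l0 lq] : (0 < l)%N && (l != q) by apply: sq; rewrite inE eqxx.
have Ql : Q`_l = 0.
  apply/eqP; apply: contraT => /Qs[lq'|ls']; first by rewrite lq' eqxx in lq.
  by rewrite ls' in ls.
have supp k : (muntz_step b l q Q)`_k != 0 -> k = q \/ k \in l :: s.
  have [->|kl] := eqVneq k l; first by right; rewrite inE eqxx.
  rewrite coef_muntz_step// mulf_eq0 negb_or => /andP[_] /Qs[|ks]; first by left.
  by right; rewrite inE ks orbT.
exists (muntz_step b l q Q); split => //.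
  rewrite coef_muntz_step 1?eq_sym// Qq mulr1 divff//.
  by rewrite subr_eq0 eqr_nat eq_sym.
rewrite big_cons -mulrA; apply: first_order_max_principle Qle => //.
- rewrite horner_coef0; apply/eqP; apply: contraT => /supp[q0'|/sq//].
  by rewrite -q0' in q0.
- exact: muntz_step_end.
- exact: muntz_step_ode.
Qed.

End Muntz.

(** * Bernoulli inequalities and polynomial approximation of a step *)

Section Bernoulli.
Local Open Scope ring_scope.
Variable R : realType.

(** Weierstrass product inequality, in the form that turns a large sum into a
    small product; it follows from [(1 - y) (1 + y + S) <= 1 + S]. *)
Lemma prod_onem_mul_le1 {I : eqType} (s : seq I) (x : I -> R) :
  {in s, forall i, 0 <= x i <= 1} ->
  0 <= \prod_(i <- s) (1 - x i) /\
  (\prod_(i <- s) (1 - x i)) * (1 + \sum_(i <- s) x i) <= 1.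
Proof.
elim: s => [_|i s IH xs]; first by rewrite !big_nil addr0 mul1r; split.
have [|P0 PS] := IH; first by move=> j js; apply: xs; rewrite inE js orbT.
have S0 : 0 <= \sum_(j <- s) x j.
  rewrite big_seq sumr_ge0// => j js.
  by have /andP[] : 0 <= x j <= 1 by apply: xs; rewrite inE js orbT.
have /andP[x0 x1] : 0 <= x i <= 1 by apply: xs; rewrite inE eqxx.
rewrite !big_cons; split; first by rewrite mulr_ge0// subr_ge0.
move: P0 PS S0 x0 x1; set P := \prod_(j <- s) _; set S := \sum_(j <- s) _.
set y := x i => P0 PS S0 y0 y1.
apply: le_trans PS; rewrite mulrC mulrA (mulrC P) ler_wpM2r//.
by have := mulr_ge0 y0 S0; have := mulr_ge0 y0 y0; nra.
Qed.

Lemma onem_expr_mul_le1 (z : R) (m : nat) : 0 <= z <= 1 ->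
  (1 - z) ^+ m * (1 + m%:R * z) <= 1.
Proof.
move=> z01; have [|_] := @prod_onem_mul_le1 _ (nseq m tt) (fun=> z).
  by [].
by rewrite !big_nseq iter_mulr_1 iter_addr_0 mulr_natl.
Qed.

Lemma onem_expr_ge (z : R) (m : nat) : 0 <= z <= 1 ->
  1 - m%:R * z <= (1 - z) ^+ m.
Proof.
move=> /andP[z0 z1]; elim: m => [|m IH]; first by rewrite mul0r subr0.
rewrite exprS; have z2 : 0 <= 1 - z by rewrite subr_ge0.
apply: le_trans (ler_wpM2l z2 IH); rewrite -natr1.
by have := mulr_ge0 z0 z0; have := ler0n R m; nra.
Qed.

(** With [s] the square root of [r], [onem_expr_mul_le1] bounds [n s ^ n]
    by [1 / (1 - s)], which leaves a geometric factor [s ^ n]. *)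
Lemma cvg_natmul_expr (r : R) : 0 <= r < 1 ->
  n%:R * r ^+ n @[n --> \oo] --> (0 : R).
Proof.
move=> /andP[r0 r1]; pose s := Num.sqrt r.
have s0 : 0 <= s by exact: sqrtr_ge0.
have s1 : s < 1 by rewrite -[ltRHS]sqrtr1 ltr_sqrt.
have t0 : 0 < 1 - s by rewrite subr_gt0.
apply: (@squeeze_cvgr _ _ _ _ (cst 0) (fun n => (1 - s)^-1 * s ^+ n)).
- near=> n; rewrite mulr_ge0 ?exprn_ge0//=.
  rewrite -(sqr_sqrtr r0) -/s -exprM mulnC exprM expr2 mulrA.
  rewrite ler_wpM2r ?exprn_ge0//.
  rewrite -div1r ler_pdivlMr// -mulrA (mulrC (s ^+ n)) mulrA.
  have := @onem_expr_mul_le1 (1 - s) n; rewrite subKr.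
  rewrite ltW//= lerBlDr lerDl => /(_ s0).
  by rewrite mulrDr mulr1 mulrC; apply: le_trans; rewrite lerDr exprn_ge0.
- exact: cvg_cst.
- rewrite -(mulr0 (1 - s)^-1); apply: cvgMl_tmp; apply: cvg_expr.
  by rewrite ger0_norm.
Unshelve. all: by end_near. Qed.

Section step.
Variables (b c : R).
Hypothesis (c0 : 0 < c).

(** With [y = x / (k c)] in [[0, 1]] and [m = (n + 1) k ^ (n + 1)], this is
    [1 - (1 - y ^ (n + 1)) ^ m], and [m y ^ (n + 1) = (n + 1) (x / c) ^ (n + 1)]
    tends to 0 or to infinity according to whether [x < c] or [c <= x]. Without
    the factor [n + 1] the limit at [x = c] would be strictly between 0 and 1,
    and an atom at [c] would be miscounted. *)
Definition step_poly (k n : nat) : {poly R} :=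
  1 - (1 - (k%:R * c) ^- n.+1 *: 'X^(n.+1)) ^+ (n.+1 * k ^ n.+1).

Variable k : nat.
Hypothesis (k0 : (0 < k)%N) (bk : b <= k%:R * c).

Lemma horner_step_poly n x :
  (step_poly k n).[x] =
  1 - (1 - (x / (k%:R * c)) ^+ n.+1) ^+ (n.+1 * k ^ n.+1).
Proof. by rewrite !(hornerE, horner_exp) expr_div_n mulrC. Qed.

Let kc0 : 0 < k%:R * c. Proof. by rewrite mulr_gt0 ?ltr0n. Qed.

Let y01 n x : 0 <= x <= b -> 0 <= (x / (k%:R * c)) ^+ n.+1 <= 1.
Proof.
move=> /andP[x0 xb]; have y0 : 0 <= x / (k%:R * c) by rewrite divr_ge0// ltW.
by rewrite exprn_ge0//= exprn_ile1// ler_pdivrMr// mul1r (le_trans xb).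
Qed.

Lemma step_poly0 n : (step_poly k n).[0] = 0.
Proof. by rewrite horner_step_poly mul0r expr0n subr0 expr1n subrr. Qed.

Lemma step_poly_bound n x : 0 <= x <= b -> 0 <= (step_poly k n).[x] <= 1.
Proof.
move=> /(y01 n)/andP[y0 y1]; rewrite horner_step_poly subr_ge0 lerBlDr lerDl.
by rewrite exprn_ile1 ?subr_ge0// ?lerBlDr ?lerDl// exprn_ge0 ?subr_ge0.
Qed.

Let exponentE n x :
  (n.+1 * k ^ n.+1)%:R * (x / (k%:R * c)) ^+ n.+1 = n.+1%:R * (x / c) ^+ n.+1.
Proof.
rewrite natrM natrX -mulrA -exprMn; congr (_ * _ ^+ _); field.
by rewrite pnatr_eq0 -lt0n k0 gt_eqF.
Qed.

(** Bernoulli's inequality bounds the polynomial by [m y ^ (n + 1)], which is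
    small left of [c]; [onem_expr_mul_le1] bounds its distance to 1 by
    [1 / (1 + m y ^ (n + 1))], which is at most [1 / (n + 1)] from [c] on. *)
Lemma cvg_step_poly (x : R) : 0 <= x <= b ->
  (step_poly k n).[x] @[n --> \oo] --> (\1_(`[c, +oo[%classic) x : R).
Proof.
move=> xb; rewrite indicE; have [xc|cx] := ltP x c.
  rewrite memNset; last by rewrite /= in_itv/= andbT leNgt xc.
  apply: (@squeeze_cvgr _ _ _ _ (cst 0) (fun n => n.+1%:R * (x / c) ^+ n.+1)).
  - near=> n; have /andP[-> _]/= := step_poly_bound n x xb.
    rewrite horner_step_poly -exponentE.
    by have := onem_expr_ge _ (n.+1 * k ^ n.+1) (y01 n x xb); lra.
  - exact: cvg_cst.
  - have /cvg_natmul_expr : 0 <= x / c < 1.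
      by case/andP: xb => x0 _; rewrite ltr_pdivrMr// mul1r xc andbT divr_ge0// ltW.
    by rewrite -(cvg_shiftn 1) => h; under eq_fun do rewrite -addn1.
rewrite mem_set; last by rewrite /= in_itv/= andbT.
apply: (@squeeze_cvgr _ _ _ _ (fun n => 1 - @harmonic R n) (cst 1)).
- near=> n; have /andP[_ ->]/= := step_poly_bound n x xb; rewrite andbT.
  rewrite horner_step_poly lerD2l lerN2 /harmonic -[leRHS]div1r ler_pdivlMr//.
  have := onem_expr_mul_le1 _ (n.+1 * k ^ n.+1) (y01 n x xb).
  rewrite exponentE; apply: le_trans; apply: ler_wpM2l.
    by case/andP: (y01 n x xb) => y0 y1; rewrite exprn_ge0 ?subr_ge0.
  rewrite ler_wpDl// ler_peMr// exprn_ege1//.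
  by rewrite ler_pdivlMr// mul1r.
- rewrite -[X in _ --> X]subr0; apply: cvgB; first exact: cvg_cst.
  exact: cvg_harmonic.
- exact: cvg_cst.
Unshelve. all: by end_near. Qed.

End step.
End Bernoulli.

(** * Sets of exponents with divergent reciprocals *)

Section Divergence.
Local Open Scope ring_scope.
Variable R : realType.

Lemma vartheta_infty (L : set nat) : ~ (vartheta R L < +oo)%E ->
  forall B : R, exists N, B < \sum_(0 <= k < N | k \in L) k%:R^-1.
Proof.
move=> Loo B; apply: contrapT => /forallNP noN; apply: Loo.
apply: (@le_lt_trans _ _ B%:E); last exact: ltry.
rewrite /vartheta /= /mseries; apply: lime_le.
  by apply: is_cvg_nneseries => n _ _; exact: measure_ge0.
near=> N; have /negP := noN N; rewrite -leNgt -lee_fin; apply: le_trans.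
rewrite -sumEFin [leRHS]big_mkcond/=; apply: lee_sum => k _.
by rewrite /mscale /= diracE; case: (_ \in _); rewrite ?mule1 ?mule0.
Unshelve. all: by end_near. Qed.

(** Exponents [k <= q] are discarded, so that every factor lies in [[0, 1]]; they
    contribute a finite amount to the divergent sum. The rest is the
    Weierstrass product inequality, since [1 / k <= q / k]. *)
Lemma muntz_prod_small (L : set nat) (q : nat) (e : R) :
  ~ (vartheta R L < +oo)%E -> (0 < q)%N -> 0 < e ->
  exists s : seq nat, [/\ uniq s, {in s, forall k, k \in L /\ (q < k)%N} &
    \prod_(k <- s) `|1 - q%:R / k%:R| <= e :> R].
Proof.
move=> Loo q0 e0.
pose T N : R := \sum_(0 <= k < N | k \in L) k%:R^-1.
(* The sum up to [q] is added so that the exponents above [q] alone exceed [e^-1]. *)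
have [N TN] := vartheta_infty L Loo (e^-1 + T q.+1).
pose s := [seq k <- index_iota q.+1 N | k \in L]; exists s.
have sP : {in s, forall k, k \in L /\ (q < k)%N}.
  by move=> k; rewrite mem_filter mem_index_iota => /and3P[].
split => //; first by rewrite filter_uniq// iota_uniq.
have x01 : {in s, forall k, 0 <= (q%:R / k%:R : R) <= 1}.
  move=> k /sP[_ qk]; have k0 := leq_ltn_trans (leq0n q) qk.
  by rewrite divr_ge0//= ler_pdivrMr ?ltr0n// mul1r ler_nat ltnW.
rewrite (eq_big_seq (fun k => 1 - q%:R / k%:R)); last first.
  by move=> k /x01/andP[_ x1]; rewrite ger0_norm// subr_ge0.
have [P0] := prod_onem_mul_le1 _ _ _ x01.
set P := \prod_(k <- s) _; set S := \sum_(k <- s) _ => PS.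
have qN : (q.+1 <= N)%N.
  rewrite leqNgt; apply/negP => Nq; move: TN; apply/negP; rewrite -leNgt.
  rewrite /T (@big_cat_nat _ _ _ N 0 q.+1)//=; last exact: ltnW.
  rewrite addrCA lerDl addr_ge0//; first by rewrite invr_ge0 ltW.
  by rewrite sumr_ge0// => k _; rewrite invr_ge0.
have eS : e^-1 < S.
  rewrite -(ltrD2r (T q.+1)) (lt_le_trans TN)// /T (big_cat_nat _ qN)//= addrC.
  rewrite lerD2r /S big_filter; apply: ler_sum => k _.
  by rewrite ler_peMl ?invr_ge0// ler1n.
have : P * e^-1 <= 1.
  by apply: le_trans PS; rewrite ler_wpM2l// (le_trans (ltW eS))// lerDr.
by rewrite ler_pdivrMr// mul1r.
Qed.
End Divergence.

(** * Moments of a measure carried by a compact interval *)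

Section Moments.
Local Open Scope ring_scope.
Context {R : realType}.
Variables a b : R.
Hypotheses (a0 : 0 < a) (ab : a < b).
Implicit Types (mu nu : @borel_finite_measure R) (p : {poly R}).

Local Notation K := (`[a, b]%classic : set (measurableTypeR R)).

Let K0b (x : R) : K x -> 0 <= x <= b.
Proof. by rewrite /= in_itv/= => /andP[ax ->]; rewrite (le_trans (ltW a0) ax). Qed.

Let b0 : 0 < b. Proof. exact: lt_trans a0 ab. Qed.

Let mK : measurable K. Proof. exact: measurable_itv. Qed.

Lemma integrable_horner mu p : mu.-integrable K (EFin \o horner p).
Proof.
apply: measurable_bounded_integrable => //.
- by rewrite ltey_eq fin_num_measure.
- exact: measurable_poly.
- have [c _ cmax] := horner_max_norm R b p (ltW b0).
  exists `|p.[c]|; split => // M cM x /K0b xb.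
  exact: le_trans (cmax x xb) (ltW cM).
Qed.

Lemma Rintegral_horner mu p : \int[mu]_(x in K) p.[x] =
  \sum_(k < size p) p`_k * \int[mu]_(x in K) (x ^+ k).
Proof.
under eq_Rintegral do rewrite horner_coef.
have intX k : mu.-integrable K (EFin \o (fun x => x ^+ k)).
  have := integrable_horner mu 'X^k; congr (_.-integrable _ (_ \o _)).
  by apply/funext => x; rewrite hornerXn.
elim: (size p) => [|n IH].
  under eq_Rintegral do rewrite big_ord0.
  by rewrite big_ord0 Rintegral_cst// mul0r.
under eq_Rintegral do rewrite big_ord_recr/=.
have intS : mu.-integrable K (EFin \o (fun x => \sum_(i < n) p`_i * x ^+ i)).
  have := integrable_horner mu (\poly_(i < n) p`_i).
  by congr (_.-integrable _ (_ \o _)); apply/funext => x; rewrite horner_poly.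
have intZ : mu.-integrable K (EFin \o (fun x => p`_n * x ^+ n)).
  have := integrable_horner mu (p`_n *: 'X^n); congr (_.-integrable _ (_ \o _)).
  by apply/funext => x; rewrite !hornerE.
by rewrite RintegralD// IH RintegralZl// big_ord_recr.
Qed.

Lemma normr_Rintegral_horner_le mu p (M : R) :
  (forall x, 0 <= x <= b -> `|p.[x]| <= M) ->
  `|\int[mu]_(x in K) p.[x]| <= M * fine (mu K).
Proof.
move=> pM; rewrite (le_trans (le_normr_Rintegral mK (integrable_horner mu p)))//.
rewrite -Rintegral_cst//; apply: le_Rintegral => //.
- exact/integrable_norm/integrable_horner.
- have := integrable_horner mu M%:P; congr (_.-integrable _ (_ \o _)).
  by apply/funext => x; rewrite hornerC.
- by move=> x /K0b; exact: pM.
Qed.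

(** For the approximant [Q] the difference of the two integrals is exactly the
    difference of the moments of exponent [q], the other exponents of [Q] being
    in [L]; it is therefore bounded by an arbitrarily small multiple of the
    total masses. *)
Lemma eq_moments mu nu (L : set nat) : ~ (vartheta R L < +oo)%E ->
  (forall k, L k ->
    \int[mu]_(x in K) (x ^+ k) = \int[nu]_(x in K) (x ^+ k)) ->
  forall q, (0 < q)%N ->
    \int[mu]_(x in K) (x ^+ q) = \int[nu]_(x in K) (x ^+ q).
Proof.
move=> Loo Leq q q0; apply/eqP; rewrite -subr_eq0 -normr_eq0; apply/negPn/negP.
set d := `|_| => dN0; have d0 : 0 < d by rewrite lt_neqAle eq_sym dN0 normr_ge0.
pose C := b ^+ q * fine (mu K) + b ^+ q * fine (nu K).
have C0 : 0 <= C.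
  by rewrite addr_ge0// mulr_ge0 ?exprn_ge0 ?fine_ge0// ltW.
have C1 : 0 < C + 1 by rewrite ltr_wpDl.
have [s [us sL sP]] := muntz_prod_small R L q (d / (C + 1)) Loo q0
  (divr_gt0 d0 C1).
have [|Q [Qq Qs Qle]] := muntz_approx R b q s b0 q0 us.
  by move=> l /sL[_ ql]; rewrite (leq_trans _ ql)//= gtn_eqF.
set e := \prod_(l <- s) _ in sP Qle.
have qQ : (q < size Q)%N.
  by rewrite ltnNge; apply/negP => /(nth_default 0) /eqP; rewrite Qq oner_eq0.
have dE : \int[mu]_(x in K) (x ^+ q) - \int[nu]_(x in K) (x ^+ q) =
    \int[mu]_(x in K) Q.[x] - \int[nu]_(x in K) Q.[x].
  rewrite !Rintegral_horner -sumrB (bigD1 (Ordinal qQ))//= Qq !mul1r.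
  rewrite big1 ?addr0// => k kq; have [->|/Qs[kq'|/sL[kL _]]] := eqVneq Q`_k 0.
  - by rewrite !mul0r subrr.
  - by move: kq; rewrite -val_eqE /= kq' eqxx.
  - by rewrite Leq ?subrr//; exact: set_mem.
have : d <= e * C.
  rewrite /d dE (le_trans (ler_normB _ _))// /C mulrDr !mulrA.
  by rewrite lerD// normr_Rintegral_horner_le.
apply/negP; rewrite -ltNge (le_lt_trans (ler_wpM2r C0 sP))//.
by rewrite mulrAC ltr_pdivrMr// ltr_pM2l// ltrDl.
Qed.

Lemma eq_Rintegral_horner mu nu p :
  (forall q, (0 < q)%N ->
    \int[mu]_(x in K) (x ^+ q) = \int[nu]_(x in K) (x ^+ q)) ->
  p.[0] = 0 -> \int[mu]_(x in K) p.[x] = \int[nu]_(x in K) p.[x].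
Proof.
rewrite horner_coef0 !Rintegral_horner => H p0; apply: eq_bigr => -[k kp] _ /=.
by case: k kp => [|k] _; rewrite ?p0 ?mul0r// H.
Qed.

Lemma eq_measure_rays mu nu :
  (forall q, (0 < q)%N ->
    \int[mu]_(x in K) (x ^+ q) = \int[nu]_(x in K) (x ^+ q)) ->
  forall c, 0 < c -> mu (`[c, +oo[%classic `&` K) = nu (`[c, +oo[%classic `&` K).
Proof.
move=> H c c0.
(* The scale [k c] must dominate [b] for the variable to lie in [[0, 1]]. *)
pose k := (Num.bound (b / c)).+1.
have bk : b <= k%:R * c.
  rewrite -ler_pdivrMr// (le_trans (ltW (archi_boundP _)))//.
    by rewrite divr_ge0// ltW.
  by rewrite ler_nat.
pose p n := step_poly R c k n.
have main (m : @borel_finite_measure R) :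
    (\int[m]_(x in K) ((p n).[x])%:E)%E @[n --> \oo]
    --> m (`[c, +oo[%classic `&` K).
  rewrite -(integral_indic m mK)//.
  have [] := @dominated_convergence _ _ R m K mK (fun n x => ((p n).[x])%:E)
     (fun x => (\1_(`[c, +oo[%classic) x)%:E) (cst 1%E).
  - move=> n; apply/measurable_EFinP; exact: measurable_poly.
  - by apply/measurable_EFinP; apply: measurable_indic.
  - apply: aeW => x /K0b xb; apply: cvg_EFin; first exact: nearW.
    exact: (@cvg_step_poly R b c).
  - exact: finite_measure_integrable_cst.
  - apply: aeW => x n /K0b /(@step_poly_bound R b c c0 k isT bk n x)/andP[x0 x1].
    by rewrite /= lee_fin ger0_norm.
  - by [].
apply: (cvg_unique _ (main mu)) => //.
have -> : (fun n => \int[mu]_(x in K) ((p n).[x])%:E)%E =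
          (fun n => \int[nu]_(x in K) ((p n).[x])%:E)%E.
  apply/funext => n.
  rewrite -[LHS]fineK; last by apply: integrable_fin_num => //; exact: integrable_horner.
  rewrite -[RHS]fineK; last by apply: integrable_fin_num => //; exact: integrable_horner.
  by congr EFin; apply: eq_Rintegral_horner => //; exact: step_poly0.
exact: main.
Qed.

End Moments.

(** * Supports and uniqueness on rays *)

Section Support.
Local Open Scope ring_scope.
Context {R : realType}.
Implicit Types mu nu : @borel_finite_measure R.

(** A point outside the support has a null open neighbourhood, hence lies in a
    null interval with rational endpoints; there are countably many of these. *)
Lemma measure_setC_support mu (K : set (measurableTypeR R)) : measurable K ->
  msupport mu `<=` K -> mu (~` K) = 0%E.
Proof.
move=> mK suppK.
pose I (qr : rat * rat) : set (measurableTypeR R) :=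
  `](ratr qr.1 : R), (ratr qr.2 : R)[%classic.
pose F n := if unpickle n is Some qr then
  if mu (I qr) == 0%E then I qr else set0 else set0.
have mI qr : measurable (I qr) by exact: measurable_itv.
apply: measure_negligible; first exact: measurableC.
apply: (negligibleS (A := \bigcup_n F n)); last first.
  apply: negligible_bigcup => n; rewrite /F.
  case: unpickle => [qr|]; last exact: negligible_set0.
  by case: eqP => [/(negligibleP mu (mI qr))|_] //; exact: negligible_set0.
move=> x Kx.
have [U [oU Ux U0]] : exists U : set R, [/\ open U, U x & mu U = 0%E].
  apply: contrapT => noU; apply: Kx; apply: suppK => U oU Ux.
  rewrite lt_neqAle measure_ge0 andbT; apply/eqP => U0; apply: noU.
  by exists U.
have [e /= e0 xe] := (nbhs_ballP x U).1 (open_nbhs_nbhs (conj oU Ux)).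
have [q /itvP xq] : exists q : rat, ratr q \in `](x - e), x[.
  by apply: rat_in_itvoo; rewrite ltrBlDr ltrDl.
have [r /itvP xr] : exists r : rat, ratr r \in `]x, (x + e)[.
  by apply: rat_in_itvoo; rewrite ltrDl.
have Fqr : F (pickle (q, r)) = if mu (I (q, r)) == 0%E then I (q, r) else set0.
  by rewrite /F pickleK.
exists (pickle (q, r)); first exact: Logic.I.
rewrite Fqr ifT; first by rewrite /I/= in_itv/= xq xr.
rewrite eq_le measure_ge0 andbT -U0; apply: le_measure; rewrite ?inE//.
  exact: open_measurable.
apply: subset_trans xe => y; rewrite /I/= in_itv/= => /andP[qy yr].
rewrite /ball/= ltr_distlC; apply/andP; split.
  by rewrite (lt_trans _ qy)// xq.
by rewrite (lt_trans yr)// xr.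
Qed.

Lemma moment_itv (a b : R) mu : 0 < a -> mu (~` `[a, b]%classic) = 0%E ->
  forall k, moment mu k = \int[mu]_(x in `[a, b]%classic) (x ^+ k).
Proof.
move=> a0 muC k; rewrite /moment /Rintegral; congr fine.
rewrite (ge0_negligible_integral _ _ _ _ muC)//.
- congr (integral _ _ _); rewrite setDE setCK setIidr// => x /=.
  by rewrite !in_itv/= andbT => /andP[ax _]; rewrite ltW// (lt_le_trans a0).
- by apply: measurableC; exact: measurable_itv.
- by apply/measurable_EFinP; exact: measurable_funX.
- by move=> x /=; rewrite in_itv/= andbT lee_fin; exact: exprn_ge0.
Qed.

Lemma measure_setI_conull (mu : @borel_finite_measure R)
    (A K : set (measurableTypeR R)) :
  measurable A -> measurable K -> mu (~` K) = 0%E -> mu (A `&` K) = mu A.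
Proof.
move=> mA mK muC; rewrite -[in RHS](setIT A) -(setUv K) setIUr measureU//.
- rewrite [X in (_ + X)%E](_ : _ = 0%E) ?adde0//.
  apply/eqP; rewrite eq_le measure_ge0 andbT -muC le_measure ?inE//.
  + by apply: measurableI => //; exact: measurableC.
  + exact: measurableC.
- exact: measurableI.
- by apply: measurableI => //; exact: measurableC.
- by rewrite setIACA setICr setI0.
Qed.

(** Closed rays are stable under intersection and generate the Borel sets, so
    Dynkin's lemma applies once the total masses agree. *)
Lemma borel_measure_unique_rays mu nu : mu setT = nu setT ->
  (forall c, mu `[c, +oo[%classic = nu `[c, +oo[%classic) ->
  forall A : set (measurableTypeR R), measurable A -> mu A = nu A.
Proof.
move=> muT mur A mA.
refine (@g_sigma_algebra_measure_unique_trace _ R (measurableTypeR R)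
  (@RGenCInfty.G R) setT measurableT _ _ mu nu muT _ _ _ A _) => //.
- by move=> _ [[c ->] _]; exact: measurable_itv.
- move=> _ _ [[c ->] _] [[d ->] _]; split => //; exists (Num.max c d).
  apply/seteqP; split => x; rewrite /= !in_itv/= !andbT ge_max.
    by move=> [-> ->].
  by move=> /andP[].
- by move=> _ [[c ->] _]; exact: mur.
- by rewrite ltey_eq fin_num_measure.
- have {mA} : (@RGenCInfty.G R).-sigma.-measurable A.
    by rewrite -RGenCInfty.measurableE.
  apply: sub_smallest2r; [exact: smallest_sigma_algebra|].
  by move=> B GB; split.
Qed.

End Support.

(** * Injectivity on compactly supported measures *)

Theorem theorem6 (R : realType) (F : set_system nat) (FU : UltraFilter F)
    (Fnonprincipal : forall n : nat, F <> principal_filter n)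
    (FMSz : MSz_filter R `<=` F)
    (mu nu : @borel_finite_measure R) (Dmu : Dco mu) (Dnu : Dco nu) :
  Phi F mu = Phi F nu ->
  forall A : set (measurableTypeR R), measurable A -> mu A = nu A.
Proof.
move=> /hyper_classP FL.
case: Dmu => _ [a1 [b1 [a10 ab1 supp1]]].
case: Dnu => _ [a2 [b2 [a20 ab2 supp2]]].
pose a := Num.min a1 a2; pose b := Num.max b1 b2.
pose K := (`[a, b]%classic : set (measurableTypeR R)).
have a0 : (0 < a)%R by rewrite lt_min a10.
have ab : (a < b)%R by rewrite gt_min lt_max ab1.
have mK : measurable K by exact: measurable_itv.
have muC : mu (~` K) = 0%E.
  apply: measure_setC_support => // x /supp1 /=; rewrite /K/= !in_itv/=.
  by move=> /andP[ax xb]; rewrite ge_min ax le_max xb.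
have nuC : nu (~` K) = 0%E.
  apply: measure_setC_support => // x /supp2 /=; rewrite /K/= !in_itv/=.
  by move=> /andP[ax xb]; rewrite ge_min ax le_max xb !orbT.
have Loo : ~ (vartheta R [set n | moment nu n = moment mu n] < +oo)%E.
  move=> Lfin; apply: (@filter_not_empty _ F _).
  have FC : F (~` [set n | moment nu n = moment mu n]).
    by apply: FMSz; rewrite /MSz_filter/= setCK.
  by rewrite -(setICr [set n | moment nu n = moment mu n]); exact: filterI.
have rays c : (0 < c)%R -> mu `[c, +oo[%classic = nu `[c, +oo[%classic.
  move=> c0; rewrite -(measure_setI_conull _ _ _ _ mK muC)//.
  rewrite -(measure_setI_conull _ _ _ _ mK nuC)//.
  apply: (eq_measure_rays a b a0 ab) => //.
  apply: (eq_moments a b a0 ab) Loo _ => k /= /esym.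
  by rewrite (moment_itv _ _ _ a0 muC) (moment_itv _ _ _ a0 nuC).
have KS (m : @borel_finite_measure R) (S : set (measurableTypeR R)) :
    measurable S -> K `<=` S -> m (~` K) = 0%E -> m S = m `[a, +oo[%classic.
  move=> mS KS mC; rewrite -(measure_setI_conull m S K)// setIidr//.
  rewrite -(measure_setI_conull m `[a, +oo[%classic K)// setIidr// => x /=.
  by rewrite /K/= !in_itv/= andbT => /andP[].
apply: borel_measure_unique_rays => [|c].
  by rewrite (KS mu setT)// (KS nu setT)//; exact: rays.
(* Below [a] the ray contains [[a, b]]; only rays from positive points are known. *)
have [ca|ac] := leP c a; last exact/rays/(lt_trans a0).
have Kc : K `<=` `[c, +oo[%classic.
  by move=> x; rewrite /K/= !in_itv/= andbT => /andP[ax _]; exact: le_trans ax.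
by rewrite (KS mu _ _ Kc)// (KS nu _ _ Kc)//; exact: rays.
Qed.
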